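(* Consider the closed-loop converter in the rotating $dq$-frame, with state $(v_{dc},i_{dq},v_{dq})\in\mathbb R\times\mathbb R^2\times\mathbb R^2$ and dynamics $$\begin{aligned}C_{dc}\dot v_{dc}&=-G_{dc}v_{dc}+i_{dc}-\tfrac{\mu}{2}\begin{bmatrix}0\\1\end{bmatrix}^\top i_{dq},\\ L\,\dot i_{dq}&=-(L\eta v_{dc}J_2+R I_2)\,i_{dq}+\tfrac{\mu}{2}\begin{bmatrix}0\\1\end{bmatrix}v_{dc}-v_{dq},\\ C\,\dot v_{dq}&=-(C\eta v_{dc}J_2+gI_2)\,v_{dq}+i_{dq}.\end{aligned}$$ Let $(v_{dc,s},i_{dq,s},v_{dq,s})\in\mathbb R^5$ be its unique real equilibrium. If $$RC^2\eta^2\|v_{dq,s}\|_2^2+gL^2\eta^2\|i_{dq,s}\|_2^2<4RG_{dc}\,g,$$ then the equilibrium is globally asymptotically stable; that is, the origin is globally asymptotically stable for the dynamics of the error $e=(v_{dc}-v_{dc,s},\,i_{dq}-i_{dq,s},\,v_{dq}-v_{dq,s})\in\mathbb R^5$.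
   Context: $C_{dc},G_{dc},C,L,R,\eta,g$ are positive constants, $\mu\in(0,1]$ is constant, $i_{dc}>0$ is the constant DC source current, $I_2$ is the $2\times2$ identity and $J_2=\begin{bmatrix}0&-1\\1&0\end{bmatrix}$. The system describes a DC/AC converter (DC capacitor voltage $v_{dc}$, inductor current $i$, AC capacitor voltage $v$) with constant resistive load $i_{load}=g\,v$, controlled by $\dot\theta_v=\eta v_{dc}$ and modulation $m_{\alpha\beta}=\mu(-\sin\theta_v,\cos\theta_v)^\top$, with AC signals transformed to the frame rotating with angle $\theta_v$. The steady state $e=0$ corresponds in the stationary $\alpha\beta$-frame to $\dot v_{dc}=0$, $\dot v_{\alpha\beta}=\omega_sJ_2v_{\alpha\beta}$, $\dot i_{\alpha\beta}=\omega_sJ_2i_{\alpha\beta}$ with $\omega_s=\eta v_{dc,s}$. It is a standing convention that the system has a unique real equilibrium. *)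

(* Defs.v *)
From HB Require Import structures.
From mathcomp Require Import all_boot all_order all_algebra.
From mathcomp Require Import all_classical all_reals all_analysis.

Set Implicit Arguments.
Unset Strict Implicit.
Unset Printing Implicit Defensive.

Import Order.TTheory GRing.Theory Num.Theory.
Import numFieldNormedType.Exports.

Local Open Scope classical_set_scope.
Local Open Scope ring_scope.

(* Parameters: Cdc, Gdc, idc on the DC side; Lac, Rac, Cac are the filter
   constants L, R, C; gload is the load conductance g. *)
Record converter (R : realType) := Converter {
  Cdc : R; Gdc : R; Cac : R; Lac : R; Rac : R;
  eta : R; gload : R; mu : R; idc : R
}.

Definition J2 (R : realType) : 'M[R]_2 := delta_mx 1 0 - delta_mx 0 1.

Definition e2 (R : realType) : 'cV[R]_2 := delta_mx 1 0.

(* The library norm on matrices is the max norm, hence this definition. *)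
Definition norm2 (R : realType) n (u : 'cV[R]_n) : R :=
  Num.sqrt (\sum_(k < n) u k 0 ^+ 2).

(* The state is (v_dc, i_dq, v_dq); each equation is divided by its coefficient
   C_dc, L, C. *)
Definition converter_field (R : realType) (p : converter R)
    (x : R * 'cV[R]_2 * 'cV[R]_2) : R * 'cV[R]_2 * 'cV[R]_2 :=
  let: (vdc, i, v) := x in
  ((Cdc p)^-1 *
     (- Gdc p * vdc + idc p - mu p / 2 * ((e2 R)^T *m i) 0 0),
   (Lac p)^-1 *:
     (- ((Lac p * eta p * vdc) *: J2 R + (Rac p)%:M) *m i
      + (mu p / 2 * vdc) *: e2 R - v),
   (Cac p)^-1 *:
     (- ((Cac p * eta p * vdc) *: J2 R + (gload p)%:M) *m v + i)).

Section Stability.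
Variables (R : realType) (V : normedModType R).
Implicit Types (f : V -> V) (x : R -> V) (xs : V).

Definition equilibrium f xs := f xs = 0.

Definition unique_equilibrium f xs :=
  equilibrium f xs /\ forall y, equilibrium f y -> y = xs.

(* Only the values of x on [0, +oo) matter.  For continuous f the differential
   equation then also holds at 0 with the one-sided derivative. *)
Definition solution f x :=
  {within `[0, +oo[, continuous x} /\
  forall t : R, 0 < t -> is_derive t 1 x (f (x t)).

Definition forward_complete f :=
  forall a : V, exists2 x, solution f x & x 0 = a.

Definition lyapunov_stable f xs :=
  forall eps : R, 0 < eps -> exists2 delta : R, 0 < delta &
    forall x, solution f x -> `|x 0 - xs| < delta ->
      forall t : R, 0 <= t -> `|x t - xs| < eps.

Definition globally_attractive f xs :=
  forall x, solution f x -> x t @[t --> +oo] --> xs.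

(* Forward completeness rules out finite escape time, which the other two
   clauses, being about solutions on [0, +oo), would not see. *)
Definition globally_asymptotically_stable f xs :=
  [/\ forward_complete f, lyapunov_stable f xs & globally_attractive f xs].

(* The vector field of e = x - xs when x' = f x. *)
Definition error_field f xs : V -> V := fun e => f (xs + e).

End Stability.

(* Main.v *)
Require Import Defs.
From mathcomp Require Import all_boot all_order all_algebra.
From mathcomp Require Import all_classical all_reals all_analysis.
From mathcomp Require Import ring lra.
Import Order.TTheory GRing.Theory Num.Theory.
Import numFieldNormedType.Exports.
Local Open Scope classical_set_scope.
Local Open Scope ring_scope.
Set Implicit Arguments.
Unset Strict Implicit.
Unset Printing Implicit Defensive.

(** The energy of the error,
    [W e = C_dc e_dc ^ 2 + L |e_i| ^ 2 + C |e_v| ^ 2],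
    is a Lyapunov function with an exponential rate.  The rotation terms of the
    dynamics are skew, so in [W'] they only survive through the steady state:
    with [D = G_dc e_dc ^ 2 + R |e_i| ^ 2 + g |e_v| ^ 2] one finds
    [W' = 2 (- D + eta e_dc X)], where [X] is bilinear in the error [(e_i, e_v)]
    and in the steady state [(i_s, v_s)].  The gain condition makes this quadratic
    form negative definite: Young's inequality turns it into
    [eta e_dc X <= theta D] with [theta < 1] ([cross_term_bound]).
    Hence [W' <= - k W] for some [k > 0] ([energy_decay]), and
    [W (e t) <= W (e 0) exp (- k t)] gives stability and attractivity at once ([exponential_lyapunov]).

    Forward completeness is the longer part.  The vector field is quadratic, so
    it is Lipschitz on balls only.  Multiplying it by a Lipschitz function
    [phi >= 0] that equals 1 on a large ball and vanishes far away gives a globally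
    Lipschitz field ([lipschitz_cutoff]), which has global solutions by the
    Picard-Lindelof theorem ([picard_lindelof]).  As [phi >= 0], the energy is
    nonincreasing along the modified field everywhere, so the solution never
    leaves the region where [phi = 1] and solves the original equation; no
    continuation argument is needed ([lyapunov_forward_complete]).

    Calculus for curves with values in the state space is reduced to real
    functions through coordinates whose maximum is the norm ([max_coords]). *)

(** * Curves in spaces normed by the maximum of finitely many coordinates *)

(** An isometry with a finite power of the reals under the sup norm.  Both
    directions are kept as plain functions, so that nested products of scalars
    and column vectors can be treated without reshaping them. *)
Record max_coords (R : realType) (V : normedModType R) := MaxCoords {
  coord_index : finType;
  coordinate : coord_index -> V -> R;
  coord_linear : forall i a u v,
    coordinate i (a *: u + v) = a * coordinate i u + coordinate i v;
  norm_coordP : forall v r, 0 <= r ->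
    `|v| <= r <-> forall i, `|coordinate i v| <= r;
  of_coord : (coord_index -> R) -> V;
  of_coordK : forall c i, coordinate i (of_coord c) = c i }.

Section Coordinates.
Context {R : realType} {V : normedModType R}.
Variable Q : max_coords V.
Implicit Types (u v : V) (i : coord_index Q).

Lemma coord0 i : coordinate i 0 = 0.
Proof.
by have := coord_linear i 1 0 0; rewrite scale1r mul1r addr0 => /eqP;
  rewrite -subr_eq subrr => /eqP.
Qed.

Lemma coordD i u v : coordinate i (u + v) = coordinate i u + coordinate i v.
Proof. by rewrite -{1}[u]scale1r coord_linear mul1r. Qed.

Lemma coordZ i a u : coordinate i (a *: u) = a * coordinate i u.
Proof. by rewrite -[a *: u]addr0 coord_linear coord0 addr0. Qed.

Lemma coordB i u v : coordinate i (u - v) = coordinate i u - coordinate i v.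
Proof. by rewrite -scaleN1r coordD coordZ mulN1r. Qed.

Lemma coord_le i v : `|coordinate i v| <= `|v|.
Proof. exact: (norm_coordP Q v (normr_ge0 v)).1. Qed.

Lemma cvg_coordP (T : Type) (F : set_system T) (f : T -> V) l : Filter F ->
  f t @[t --> F] --> l <-> forall i, coordinate i (f t) @[t --> F] --> coordinate i l.
Proof.
move=> FF; split=> [/cvgrPdist_le fl i|fl].
  apply/cvgrPdist_le => e e0; apply: filterS (fl e e0) => t.
  by apply: le_trans; rewrite -coordB coord_le.
apply/cvgrPdist_le => e e0.
have : \forall t \near F, forall i, `|coordinate i l - coordinate i (f t)| <= e.
  by apply: filter_forall => i; move/cvgrPdist_le : (fl i); apply.
apply: filterS => t H; apply/(norm_coordP Q _ (ltW e0)) => i.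
by rewrite coordB.
Qed.

Lemma is_derive_cvgP (W : normedModType R) (x : R -> W) (t : R) w :
  is_derive t 1 x w <->
  (h^-1 *: ((x \o shift t) (h *: (1 : R)) - x t)) @[h --> 0^'] --> w.
Proof.
split=> [[dx xv]|xv].
  by rewrite -xv; exact: dx.
apply: DeriveDef; first by apply/cvg_ex; exists w.
by apply/cvg_lim => //; exact: norm_hausdorff.
Qed.

(** A difference quotient converges as soon as its coordinates do. *)
Lemma is_derive_coordP (x : R -> V) (t : R) v :
  is_derive t 1 x v <-> forall i, is_derive t 1 (coordinate i \o x) (coordinate i v).
Proof.
split=> [/is_derive_cvgP /cvg_coordP xv i|xv].
  apply/is_derive_cvgP; move: (xv i); apply: cvg_trans.
  by apply: near_eq_cvg; near=> h; rewrite coordZ coordB.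
apply/is_derive_cvgP/cvg_coordP => i.
have /is_derive_cvgP := xv i; apply: cvg_trans.
by apply: near_eq_cvg; near=> h; rewrite /= coordZ coordB.
Unshelve. all: by end_near. Qed.

Lemma continuous_coord i : continuous (coordinate i).
Proof. by move=> v; have /cvg_coordP := @cvg_id _ (nbhs v); apply. Qed.

Lemma is_derive_continuous (W : normedModType R) (x : R -> W) (t : R) w :
  is_derive t 1 x w -> {for t, continuous x}.
Proof. by move=> [/derivable1_diffP/differentiable_continuous]. Qed.

End Coordinates.

(** * Growth bounds, primitives and geometric limits *)

Section ScalarCalculus.
Context {R : realType}.
Implicit Types (f : R -> R) (t : R).

Lemma nonincreasing_of_derive f df t :
  {within `[0, +oo[, continuous f} ->
  (forall s : R, 0 < s -> is_derive s 1 f (df s)) ->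
  (forall s : R, 0 < s -> df s <= 0) ->
  0 <= t -> f t <= f 0.
Proof.
move=> cf fdf df0 t0; apply: (@ler0_derive1_nincry _ f 0) => //.
- by move=> s; rewrite in_itv/= andbT => /fdf[].
- by move=> s; rewrite in_itv/= andbT => s0; have [_] := fdf _ s0;
    rewrite derive1E => ->; exact: df0.
Qed.

Lemma is_derive_expRM (k t : R) :
  is_derive t 1 (fun s => expR (k * s)) (k * expR (k * t)).
Proof.
have kt : is_derive t 1 (fun s : R => k * s) k.
  have := @is_deriveZ R R R id k t 1 1 _; rewrite /GRing.scale/= mulr1; exact.
by rewrite mulrC; apply: is_derive1_comp.
Qed.

(** Integrating from -1 makes 0 an interior point, so that the primitive is
    differentiable at 0 as well. *)
Lemma continuous_primitive f : continuous f ->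
  exists2 G : R -> R, G 0 = 0 & forall t, 0 <= t -> is_derive t 1 G (f t).
Proof.
move=> cf.
pose G x := (\int[lebesgue_measure]_(t in `[(-1 : R), x]) f t)%R.
exists (fun x => G x - G 0); first by rewrite subrr.
move=> t t0.
have [] := @continuous_FTC1_closed R f (-1) t (t + 1) _ _ _ (cf t).
- by rewrite ltrDl.
- apply: continuous_compact_integrable; first exact: segment_compact.
  by apply: continuous_subspaceT.
- by lra.
rewrite -/G => dG Gt; rewrite -[f t]subr0; apply: is_deriveB.
by apply: DeriveDef; [exact: dG | rewrite -Gt derive1E].
Qed.

(** With geometrically small increments the sequences
    [u n - 2 c / 2 ^ n] and [u n + 2 c / 2 ^ n] are monotone and enclose the
    limit, which is the supremum of the first one. *)
Lemma geometric_limit (u : R^nat) (c : R) :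
  (forall n, `|u n.+1 - u n| <= c / 2 ^+ n) ->
  exists l, forall n, `|l - u n| <= 2 * c / 2 ^+ n.
Proof.
move=> uc; pose d n := c / 2 ^+ n.
have dS n : d n = 2 * d n.+1 by rewrite /d exprS; field.
have ue n : u n.+1 - d n <= u n <= u n.+1 + d n.
  by move: (uc n); rewrite ler_norml => /andP[h1 h2]; apply/andP; split;
    rewrite /d; lra.
have d0 n : 0 <= d n by apply: le_trans (uc n).
have lo : {homo (fun n => u n - 2 * d n) : m n / (m <= n)%N >-> m <= n}.
  by apply/nondecreasing_seqP => n; have := ue n; rewrite dS => /andP[]; lra.
have hi : {homo (fun n => u n + 2 * d n) : m n / (m <= n)%N >-> n <= m}.
  by apply/nonincreasing_seqP => n; have := ue n; rewrite dS => /andP[]; lra.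
have lohi m n : u m - 2 * d m <= u n + 2 * d n.
  have := lo _ _ (leq_maxl m n); have := hi _ _ (leq_maxr m n).
  by have := d0 (maxn m n); lra.
pose S := range (fun n => u n - 2 * d n).
have S0 : S !=set0 by exists (u 0%N - 2 * d 0%N), 0%N.
have ubS n : ubound S (u n + 2 * d n) by move=> _ [m _ <-].
exists (sup S) => n; rewrite -mulrA -/(d n) ler_norml; apply/andP; split.
  rewrite lerBrDr addrC; apply: ub_le_sup; first by exists (u n + 2 * d n).
  by exists n.
by rewrite lerBlDr addrC; apply: ge_sup.
Qed.

End ScalarCalculus.

Section CurveCalculus.
Context {R : realType} {V : normedModType R} (Q : max_coords V).

(** A mean value inequality for the majorant [c * expR (k * t)].  With [k] twice
    a Lipschitz constant, it makes each Picard iteration halve the distance. *)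
Lemma exp_growth_bound (x v : R -> V) (c k : R) :
  0 <= c -> continuous x -> x 0 = 0 ->
  (forall t : R, 0 < t -> is_derive t 1 x (v t)) ->
  (forall t : R, 0 < t -> `|v t| <= c * (k * expR (k * t))) ->
  forall t, 0 <= t -> `|x t| <= c * expR (k * t).
Proof.
move=> c0 cx x0 xv vc t t0.
apply/(norm_coordP Q); first by rewrite mulr_ge0 ?expR_ge0.
move=> i.
have ce (s : R) : is_derive s 1 (fun s : R => c * expR (k * s)) (c * (k * expR (k * s))).
  exact: is_deriveZ (is_derive_expRM k s).
(* Used with e = 1 and e = -1, which together bound the absolute value. *)
have bound (e : R) : `|e| = 1 -> e * coordinate i (x t) <= c * expR (k * t).
  move=> e1; rewrite -subr_le0.
  pose f s := e * coordinate i (x s) - c * expR (k * s).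
  have dx (s : R) : 0 < s ->
    is_derive s 1 (fun s => e * coordinate i (x s)) (e * coordinate i (v s)).
    by move=> s0; have /is_derive_coordP/(_ i) xi := xv _ s0; exact: is_deriveZ.
  apply: (@le_trans _ _ (f 0)).
    pose df s := e * coordinate i (v s) - c * (k * expR (k * s)).
    apply: (@nonincreasing_of_derive _ f df) => //.
    - apply: continuous_subspaceT => s.
      apply: cvgB; last exact: is_derive_continuous (ce s).
      apply: cvgM; first exact: cvg_cst.
      by apply: (continuous_comp (cx s)); exact: continuous_coord.
    - by move=> s s0; apply: is_deriveB; exact: dx.
    - move=> s s0; rewrite subr_le0; apply: le_trans (vc s s0).
      by apply: le_trans (ler_norm _) _; rewrite normrM e1 mul1r; exact: coord_le.
  by rewrite /f x0 coord0 !mulr0 expR0 sub0r mulr1 oppr_le0.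
rewrite ler_norml lerNl -mulN1r -[X in _ && (X <= _)]mul1r !bound ?normrN ?normr1//.
Qed.

Lemma curve_primitive (g : R -> V) : continuous g ->
  exists2 G : R -> V, G 0 = 0 & forall t : R, 0 <= t -> is_derive t 1 G (g t).
Proof.
move=> cg.
have /choice[G GP] (i : coord_index Q) : exists G : R -> R,
    G 0 = 0 /\ forall t : R, 0 <= t -> is_derive t 1 G (coordinate i (g t)).
  have [] := @continuous_primitive R (coordinate i \o g); last by move=> G;
    exists G.
  by move=> t; apply: (continuous_comp (cg t)); exact: (@continuous_coord _ _ Q).
exists (fun t => of_coord (G^~ t)).
  by apply/eqP; rewrite -normr_le0; apply/(norm_coordP Q) => // i;
    rewrite of_coordK (GP i).1 normr0.
move=> t t0; apply/(is_derive_coordP Q) => i.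
rewrite (_ : _ \o _ = G i); first exact: (GP i).2.
by apply/funext => s /=; rewrite of_coordK.
Qed.

Lemma geometric_limit_curve (u : nat -> V) (c : R) :
  (forall n, `|u n.+1 - u n| <= c / 2 ^+ n) ->
  exists l, forall n, `|l - u n| <= 2 * c / 2 ^+ n.
Proof.
move=> uc.
have /choice[l lP] (i : coord_index Q) : exists l : R,
    forall n, `|l - coordinate i (u n)| <= 2 * c / 2 ^+ n.
  by apply: geometric_limit => n; rewrite -coordB; apply: le_trans (uc n);
    exact: coord_le.
have c0 : 0 <= c by have := uc 0%N; rewrite expr0 divr1; apply: le_trans.
exists (of_coord l) => n; apply/(norm_coordP Q) => [|i].
  by rewrite divr_ge0 ?exprn_ge0 ?mulr_ge0.
by rewrite coordB of_coordK.
Qed.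

End CurveCalculus.

(** * Global solutions for globally Lipschitz vector fields *)

Section PicardLindelof.
Context {R : realType} {V : normedModType R} (Q : max_coords V).

Lemma half_pow_small (d e : R) : 0 < e -> exists n, d / 2 ^+ n <= e.
Proof.
move=> e0.
have : geometric d (2^-1) n @[n --> \oo] --> (0 : R).
  by apply: cvg_geometric; rewrite ger0_norm ?invr_ge0// invf_lt1// ltr1n.
move=> /cvgrPdist_le/(_ e e0)[n _ /(_ n (leqnn _))] /=.
rewrite sub0r normrN exprVn => h; exists n; exact: le_trans (ler_norm _) h.
Qed.

Lemma eq_of_geometric_bound (u v : V) (d : R) :
  (forall n, `|u - v| <= d / 2 ^+ n) -> u = v.
Proof.
move=> uv; apply/eqP; rewrite -subr_eq0 -normr_le0; apply/ler_addgt0Pr => e e0.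
by have [n dn] := half_pow_small d e0; rewrite add0r; apply: le_trans dn.
Qed.

(** The Picard operator [w |-> a + \int_0^t F (w s) ds], extended by the constant
    [a] to negative times so that iterates are continuous on the whole line. *)
Lemma picard_step (F : V -> V) (a : V) (w : R -> V) : continuous F ->
  continuous w ->
  exists w' : R -> V, [/\ continuous w', forall t, t <= 0 -> w' t = a &
    forall t : R, 0 < t -> is_derive t 1 w' (F (w t))].
Proof.
move=> cF cw.
have [|G G0 GP] := curve_primitive Q (g := F \o w).
  by move=> t; apply: continuous_comp; [exact: cw | exact: cF].
exists (fun t => a + G (Num.max t 0)); split.
- move=> t; apply: cvgD; first exact: cvg_cst.
  apply: (@continuous_comp R R V (fun t => Num.max t 0) G t).
    by apply: continuous_max; [exact: cvg_id|exact: cvg_cst].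
  by apply: is_derive_continuous; apply: GP; rewrite le_max lexx orbT.
- by move=> t t0; rewrite max_r// G0 addr0.
- move=> t t0.
  apply: (@near_eq_is_derive _ _ _ (fun s => a + G s)).
    by near=> s; rewrite max_l//; near: s; apply: (cvgr_ge t) => //; exact: cvg_id.
  rewrite -[F _]add0r; apply: is_deriveD; apply: GP; exact: ltW.
Unshelve. all: by end_near. Qed.

(** Successive iterates satisfy [|u_(n+1) t - u_n t| <= c 2^-n exp (2 K t)], so they
    converge geometrically at each [t], with a rate that is uniform near [t].
    The limit [x] is therefore continuous, and its image [S x] under the Picard
    operator satisfies the same estimate as [x], whence [S x = x]. *)
Theorem picard_lindelof (F : V -> V) (K : R) (a : V) : 0 < K ->
  (forall u v, `|F u - F v| <= K * `|u - v|) ->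
  exists x : R -> V, [/\ continuous x, x 0 = a &
    forall t : R, 0 < t -> is_derive t 1 x (F (x t))].
Proof.
move=> K0 lipF.
have cF : continuous F.
  move=> u; apply/cvgrPdist_le => e e0; near=> v.
  apply: le_trans (lipF _ _) _; rewrite -ler_pdivlMl//.
  by near: v; apply: cvgr_dist_le; [exact: cvg_id | rewrite mulr_gt0 ?invr_gt0].
have /choice[S SP] (w : R -> V) : exists w' : R -> V, continuous w ->
    [/\ continuous w', forall t, t <= 0 -> w' t = a &
    forall t : R, 0 < t -> is_derive t 1 w' (F (w t))].
  have [cw|ncw] := pselect (continuous w); last by exists w.
  by have [w' w'P] := picard_step a cF cw; exists w'.
pose u n := iter n S (cst a).
have cu n : continuous (u n).
  by elim: n => [t|n IH]; [exact: cvg_cst | have [] := SP _ IH].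
have ua n t : t <= 0 -> u n t = a.
  by case: n => [//|n]; have [_ + _] := SP _ (cu n); apply.
(* This c makes the bound hold for n = 0, as the first increment has the
   constant derivative F a. *)
pose c := `|F a| / (2 * K).
have c0 n : 0 <= c / 2 ^+ n by rewrite !divr_ge0 ?exprn_ge0// mulr_ge0// ltW.
pose E t := expR (2 * K * t).
have E0 t : 0 <= E t by exact: expR_ge0.
have du n t : 0 <= t -> `|u n.+1 t - u n t| <= c / 2 ^+ n * E t.
  elim: n t => [|n IH] t t0.
    apply: (exp_growth_bound Q (x := u 1%N \- u 0%N) (v := fun=> F a)) => //.
    - by move=> s; apply: cvgB; exact: cu.
    - by rewrite -[LHS]/(u 1%N 0 - u 0%N 0) !ua// subrr.
    - move=> s s0; rewrite -[F a]subr0; apply: is_deriveB.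
      by have [_ _] := SP _ (cu 0%N); exact.
    - move=> s s0; rewrite expr0 divr1 /c mulrA divfK ?ler_peMr//.
        by apply: le_trans (expR_ge1Dx _); rewrite lerDl !mulr_ge0// ltW.
      by rewrite mulf_neq0// gt_eqF.
  apply: (exp_growth_bound Q (x := u n.+2 \- u n.+1)
    (v := fun s => F (u n.+1 s) - F (u n s))) => //.
  - by move=> s; apply: cvgB; exact: cu.
  - by rewrite -[LHS]/(u n.+2 0 - u n.+1 0) !ua// subrr.
  - move=> s s0; apply: is_deriveB.
      by have [_ _] := SP _ (cu n.+1); exact.
    by have [_ _] := SP _ (cu n); exact.
  - move=> s s0; apply: le_trans (lipF _ _) _.
    apply: le_trans (_ : K * (c / 2 ^+ n * E s) <= _).
      by rewrite ler_pM2l// IH// ltW.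
    by rewrite le_eqVlt /E exprS; apply/orP; left; apply/eqP; field;
      rewrite ?expf_neq0.
have /choice[x xP] (t : R) : exists l, forall n,
    `|l - u n t| <= 2 * (c * E (Num.max t 0)) / 2 ^+ n.
  apply: (geometric_limit_curve Q) => n; rewrite mulrAC.
  have [t0|t0] := leP 0 t; first exact: du.
  by rewrite !ua ?(ltW t0)// subrr normr0; apply: mulr_ge0; [exact: c0 | exact: E0].
have cx : continuous x.
  move=> t; apply/cvgrPdist_le => e e0.
  pose d := E (Num.max t 0) + 1.
  have [n nP] := half_pow_small (2 * (c * d)) (divr_gt0 e0 (ltr0n R 3)).
  have xu s : E (Num.max s 0) <= d -> `|x s - u n s| <= e / 3.
    move=> sd; apply: le_trans nP; apply: le_trans (xP s n) _.
    rewrite ler_pM2r ?invr_gt0 ?exprn_gt0// ler_pM2l// ler_wpM2l//.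
    by have := c0 0%N; rewrite expr0 divr1.
  near=> s.
  have -> : x t - x s = (x t - u n t) + (u n t - u n s) - (x s - u n s).
    by rewrite subrKA opprB addrA subrK.
  rewrite (_ : e = e / 3 + e / 3 + e / 3); last by field.
  apply: le_trans (ler_normB _ _) _; apply: lerD; last first.
    apply: xu; near: s; apply: (cvgr_le (E (Num.max t 0)));
      last by rewrite /d ltrDl.
    apply: (@continuous_comp R R R (fun s => Num.max s 0) E t).
      by apply: continuous_max; [exact: cvg_id|exact: cvg_cst].
    exact: is_derive_continuous (is_derive_expRM _ _).
  apply: le_trans (ler_normD _ _) _; apply: lerD; first by apply: xu; rewrite lerDl.
  by near: s; apply: cvgr_dist_le; [exact: cu | rewrite divr_gt0].
have [cy ya dy] := SP _ cx.
have yx t : S x t = x t.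
  have [t0|t0] := leP 0 t; last first.
    rewrite (ya _ (ltW t0));
      apply/esym/(@eq_of_geometric_bound _ _ (2 * (c * E (Num.max t 0)))) => n.
    by have := xP t n; rewrite (ua _ _ (ltW t0)).
  apply: (@eq_of_geometric_bound _ _ (2 * (c * E t))) => n.
  rewrite -(subrKA (u n.+1 t)) (_ : 2 * _ / _ = c / 2 ^+ n * E t + c / 2 ^+ n * E t);
    last by field.
  apply: le_trans (ler_normD _ _) _; apply: lerD; last first.
    rewrite distrC; apply: le_trans (xP t n.+1) _; rewrite max_l//.
    by rewrite le_eqVlt exprS; apply/orP; left; apply/eqP; field;
      rewrite ?expf_neq0.
  apply: (exp_growth_bound Q (x := S x \- u n.+1)
    (v := fun s => F (x s) - F (u n s))) => //.
  - by move=> s; apply: cvgB; [exact: cy | exact: cu].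
  - by rewrite -[LHS]/(S x 0 - u n.+1 0) ya// ua// subrr.
  - move=> s s0; apply: is_deriveB; first exact: dy.
    by have [_ _] := SP _ (cu n); exact.
  - move=> s s0; apply: le_trans (lipF _ _) _.
    apply: le_trans (_ : K * (2 * (c * E s) / 2 ^+ n) <= _).
      by rewrite ler_pM2l//; have := xP s n; rewrite max_l// ltW.
    by rewrite le_eqVlt /E; apply/orP; left; apply/eqP; field; rewrite ?expf_neq0.
exists x; split=> //; first by rewrite -yx ya.
by move=> t t0; rewrite -(_ : S x = x); [rewrite yx; exact: dy | exact/funext].
Unshelve. all: by end_near. Qed.

End PicardLindelof.

(** * Maps that are Lipschitz on balls *)

Section LipschitzOnBalls.
Context {R : realType}.
Implicit Types U V W : normedModType R.

Definition lipschitz_on_balls U V (f : U -> V) := forall M : R,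
  exists2 K : R, 0 < K & forall u v, `|u| <= M -> `|v| <= M ->
    `|f u - f v| <= K * `|u - v|.

Lemma lipschitz_lipschitz_on_balls U V (f : U -> V) (K : R) :
  (forall u v, `|f u - f v| <= K * `|u - v|) -> lipschitz_on_balls f.
Proof.
move=> fK M; exists (Num.max K 1); first by rewrite lt_max ltr01 orbT.
move=> u v _ _; apply: le_trans (fK u v) _.
by rewrite ler_wpM2r// le_max lexx.
Qed.

Lemma bounded_on_balls U V (f : U -> V) M : lipschitz_on_balls f ->
  exists2 B : R, 0 <= B & forall u, `|u| <= M -> `|f u| <= B.
Proof.
move=> fl; have [M0|M0] := leP 0 M; last first.
  exists 0 => // u uM; have := le_lt_trans uM M0.
  by rewrite normr_lt0.
have [K K0 fK] := fl M; exists (`|f 0| + K * M).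
  by rewrite addr_ge0// mulr_ge0// ltW.
move=> u uM; rewrite -[f u](subrK (f 0)) addrC.
apply: le_trans (ler_normD _ _) _; rewrite lerD2l.
apply: le_trans (fK _ _ uM _) _; first by rewrite normr0.
by rewrite subr0 ler_pM2l.
Qed.

Lemma lipschitz_on_balls_cst U V (a : V) : lipschitz_on_balls (fun _ : U => a).
Proof.
apply: (@lipschitz_lipschitz_on_balls _ _ _ 0) => u v.
by rewrite subrr normr0 mul0r.
Qed.

Lemma lipschitz_on_balls_id U : lipschitz_on_balls (fun u : U => u).
Proof. by apply: (@lipschitz_lipschitz_on_balls _ _ _ 1) => u v; rewrite mul1r. Qed.

Lemma lipschitz_on_balls_comp U V W (f : U -> V) (g : V -> W) :
  lipschitz_on_balls f -> lipschitz_on_balls g ->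
    lipschitz_on_balls (fun u => g (f u)).
Proof.
move=> fl gl M; have [B _ fB] := bounded_on_balls M fl.
have [K K0 fK] := fl M; have [L L0 gL] := gl B.
exists (L * K) => [|u v uM vM]; first exact: mulr_gt0.
apply: le_trans (gL _ _ (fB _ uM) (fB _ vM)) _.
by rewrite -mulrA ler_pM2l// fK.
Qed.

Lemma lipschitz_on_ballsD U V (f g : U -> V) :
  lipschitz_on_balls f -> lipschitz_on_balls g ->
    lipschitz_on_balls (fun u => f u + g u).
Proof.
move=> fl gl M; have [K K0 fK] := fl M; have [L L0 gL] := gl M.
exists (K + L) => [|u v uM vM]; first exact: addr_gt0.
rewrite opprD addrACA mulrDl; apply: le_trans (ler_normD _ _) _.
by rewrite lerD ?fK ?gL.
Qed.

Lemma lipschitz_on_ballsZ U V (k : U -> R) (f : U -> V) :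
  lipschitz_on_balls k -> lipschitz_on_balls f ->
    lipschitz_on_balls (fun u => k u *: f u).
Proof.
move=> kl fl M; have [K K0 kK] := kl M; have [L L0 fL] := fl M.
have [A A0 kA] := bounded_on_balls M kl; have [B B0 fB] := bounded_on_balls M fl.
exists (A * L + K * B + 1) => [|u v uM vM].
  by rewrite ltr_wpDl// addr_ge0// mulr_ge0// ltW.
have -> : k u *: f u - k v *: f v = k u *: (f u - f v) + (k u - k v) *: f v.
  by rewrite scalerBr scalerBl addrA subrK.
apply: le_trans (ler_normD _ _) _; rewrite !normrZ.
rewrite [leRHS](_ : _ = A * (L * `|u - v|) + K * `|u - v| * B + `|u - v|);
  last by ring.
rewrite ler_wpDr// lerD// ler_pM ?kA ?fL ?kK ?fB//.
Qed.

Lemma lipschitz_on_balls_pair U V W (f : U -> V) (g : U -> W) :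
  lipschitz_on_balls f -> lipschitz_on_balls g ->
    lipschitz_on_balls (fun u => (f u, g u)).
Proof.
move=> fl gl M; have [K K0 fK] := fl M; have [L L0 gL] := gl M.
exists (K + L) => [|u v uM vM]; first exact: addr_gt0.
rewrite prod_normE ge_max/= mulrDl; apply/andP; split.
  by rewrite ler_wpDr ?fK// mulr_ge0// ltW.
by rewrite ler_wpDl ?gL// mulr_ge0// ltW.
Qed.

(** Take [phi v = max (0, min (1, 2 - |v| / M))], which vanishes outside the ball of
    radius [2 M].  If one of the points, say [v], lies in that ball, then
    [phi u f u - phi v f v = phi u (f u - f v) + (phi u - phi v) f v], where the
    first term vanishes unless [u] lies in it too. *)
Lemma lipschitz_cutoff V (f : V -> V) (M : R) : 0 < M -> lipschitz_on_balls f ->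
  exists phi : V -> R, [/\ forall v, 0 <= phi v, forall v, `|v| <= M -> phi v = 1 &
    exists2 K : R, 0 < K & forall u v, `|phi u *: f u - phi v *: f v| <= K * `|u - v|].
Proof.
move=> M0 fl.
pose phi (v : V) : R := Num.max 0 (Num.min 1 (2 - `|v| / M)).
have phi_ge0 v : 0 <= phi v by rewrite le_max lexx.
have phi_le1 v : phi v <= 1 by rewrite ge_max ler01 ge_min lexx.
have phi_out v : 2 * M < `|v| -> phi v = 0.
  move=> vM; apply: max_l; rewrite ge_min; apply/orP; right.
  by rewrite subr_le0 ler_pdivlMr// ltW.
have max_lip (p q : R) : `|Num.max 0 p - Num.max 0 q| <= `|p - q|.
  have := ler_norm (p - q); have := ler_norm (q - p); rewrite [`|q - p|]distrC.
  by move=> ? ?; case: (leP _ p) => ?; case: (leP _ q) => ?; rewrite ler_norml;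
    apply/andP; split; lra.
have min_lip (p q : R) : `|Num.min 1 p - Num.min 1 q| <= `|p - q|.
  have := ler_norm (p - q); have := ler_norm (q - p); rewrite [`|q - p|]distrC.
  by move=> ? ?; case: (leP _ p) => ?; case: (leP _ q) => ?; rewrite ler_norml;
    apply/andP; split; lra.
have phi_lip u v : `|phi u - phi v| <= M^-1 * `|u - v|.
  have uv : `| `|u| / M - `|v| / M| <= M^-1 * `|u - v|.
    rewrite -mulrBl normrM mulrC [`|M^-1|]gtr0_norm ?invr_gt0//.
    by rewrite ler_pM2l ?invr_gt0// ler_dist_dist.
  apply: le_trans uv; apply: le_trans (max_lip _ _) _.
  apply: le_trans (min_lip _ _) _.
  by rewrite opprB addrC addrA subrK distrC.
exists phi; split => //.
  move=> v vM; rewrite /phi min_l; first by rewrite max_r.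
  rewrite lerBrDl -lerBrDr -[leRHS]/(1 + 1 - 1) addrK.
  by rewrite ler_pdivrMr// mul1r.
have [K K0 fK] := fl (2 * M); have [B B0 fB] := bounded_on_balls (2 * M) fl.
pose L := K + M^-1 * B; exists L.
  by rewrite ltr_wpDr// mulr_ge0// invr_ge0 ltW.
have main u v : `|v| <= 2 * M -> `|phi u *: f u - phi v *: f v| <= L * `|u - v|.
  move=> vM.
  have -> : phi u *: f u - phi v *: f v = phi u *: (f u - f v) + (phi u - phi v) *: f v.
    by rewrite scalerBr scalerBl addrA subrK.
  rewrite [leRHS]mulrDl; apply: le_trans (ler_normD _ _) _; rewrite !normrZ.
  apply: lerD; last by rewrite mulrAC ler_pM ?fB.
  have [uM|/phi_out ->] := leP `|u| (2 * M);
    last by rewrite normr0 mul0r mulr_ge0// ltW.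
  by rewrite ger0_norm// -[leRHS]mul1r ler_pM ?fK.
move=> u v; have [/main//|vM] := leP `|v| (2 * M).
have [uM|uM] := leP `|u| (2 * M); first by rewrite distrC [`|u - v|]distrC main.
rewrite !phi_out// !scale0r subrr normr0 mulr_ge0//.
by rewrite addr_ge0 ?mulr_ge0 ?invr_ge0 // ltW.
Qed.

End LipschitzOnBalls.

(** * Exponential Lyapunov functions *)

(** [dW u v] stands for the derivative of [W] at [u] in the direction [v]; only
    the chain rule along curves and homogeneity in [v] are required of it. *)
Section ExponentialLyapunov.
Context {R : realType} {V : normedModType R} (Q : max_coords V).
Variables (f : V -> V) (W : V -> R) (dW : V -> V -> R) (m M k : R).
Hypotheses (m0 : 0 < m) (M0 : 0 < M) (k0 : 0 < k).
Hypothesis f_lip : lipschitz_on_balls f.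
Hypothesis W_cont : continuous W.
Hypothesis W_chain : forall (x : R -> V) (t : R) v,
  is_derive t 1 x v -> is_derive t 1 (W \o x) (dW (x t) v).
Hypothesis dWZ : forall u a v, dW u (a *: v) = a * dW u v.
Hypothesis W_lower : forall v, m * `|v| ^+ 2 <= W v.
Hypothesis W_upper : forall v, W v <= M * `|v| ^+ 2.
Hypothesis W_decay : forall v, dW v (f v) <= - k * W v.

Lemma within_continuous_comp (A : set R) (x : R -> V) :
  {within A, continuous x} -> {within A, continuous (W \o x)}.
Proof.
move=> cx t; exact: (@continuous_comp (subspace A) V R x W t (cx t) (@W_cont (x t))).
Qed.

Lemma W_ge0 v : 0 <= W v.
Proof. by apply: le_trans (W_lower v); rewrite mulr_ge0 ?exprn_ge0// ltW. Qed.

(** [W (x t) * expR (k * t)] is nonincreasing. *)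
Lemma exponential_decay x t : solution f x -> 0 <= t ->
  W (x t) <= W (x 0) * expR (- k * t).
Proof.
move=> [cx dx] t0.
pose h s := W (x s) * expR (k * s).
pose dh s := W (x s) * (k * expR (k * s)) + expR (k * s) * dW (x s) (f (x s)).
suff : h t <= h 0.
  by rewrite /h mulr0 expR0 mulr1 -ler_pdivlMr ?expR_gt0// -expRN mulNr.
apply: (@nonincreasing_of_derive _ h dh) => //.
- move=> s; apply: cvgM; first exact: within_continuous_comp.
  apply: continuous_subspaceT => {}s.
  exact: is_derive_continuous (is_derive_expRM k s).
- move=> s s0.
  have Wx := W_chain (dx _ s0); have ex := is_derive_expRM k s.
  exact: is_deriveM.
- move=> s s0.
  have -> : dh s = (k * W (x s) + dW (x s) (f (x s))) * expR (k * s).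
    by rewrite /dh; ring.
  rewrite mulr_le0_ge0 ?expR_ge0//.
  by have := W_decay (x s); rewrite mulNr; lra.
Qed.

(** Along [phi * f] with [phi >= 0] the function [W] still decreases, at every point
    of the space.  The ball on which [phi = 1] is chosen to contain the sublevel
    set of the initial value, so the solution for [phi * f] solves the equation
    for [f]. *)
Lemma lyapunov_forward_complete : forward_complete f.
Proof.
move=> a.
(* The square of this r dominates W a / m because r >= 1. *)
pose r := W a / m + 1.
have r1 : 1 <= r by rewrite lerDr divr_ge0 ?W_ge0// ltW.
have r0 : 0 <= r by exact: le_trans r1.
have [phi [phi0 phi1 [K K0 FK]]] := lipschitz_cutoff (lt_le_trans ltr01 r1) f_lip.
have [x [cx x0 dx]] := picard_lindelof Q a K0 FK.
exists x => //; split; first exact: continuous_subspaceT.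
have Wx t : 0 <= t -> W (x t) <= W a.
  move=> t0; rewrite -x0.
  apply: (@nonincreasing_of_derive _ (W \o x)
    (fun s => dW (x s) (phi (x s) *: f (x s)))) => //.
  - by apply: within_continuous_comp; exact: continuous_subspaceT.
  - by move=> s s0; apply: W_chain; exact: dx.
  - move=> s s0; rewrite dWZ mulr_ge0_le0//; apply: le_trans (W_decay _) _.
    by rewrite mulNr oppr_le0 mulr_ge0 ?W_ge0// ltW.
move=> t t0; have := dx _ t0; rewrite phi1 ?scale1r//.
rewrite -(ler_pXn2r (n := 2)) ?nnegrE//.
apply: (@le_trans _ _ r); last by rewrite expr2 ler_peMl.
rewrite ler_wpDr// ler_pdivlMr// mulrC; apply: le_trans (W_lower _) _.
exact/Wx/ltW.
Qed.

Lemma exponential_lyapunov : globally_asymptotically_stable f 0.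
Proof.
have decay x t : solution f x -> 0 <= t ->
  m * `|x t| ^+ 2 <= W (x 0) * expR (- k * t).
  by move=> xf t0; apply: le_trans (W_lower _) _; exact: exponential_decay.
split; first exact: lyapunov_forward_complete.
(* As r <= 1, one has M * (e * r) ^+ 2 <= M * e ^+ 2 * r <= m * e ^+ 2. *)
- move=> e e0; pose r := Num.min 1 (m / M).
  have r0 : 0 < r by rewrite lt_min ltr01 divr_gt0.
  exists (e * r); first exact: mulr_gt0.
  move=> x xf; rewrite subr0 => x0 t t0; rewrite subr0.
  rewrite -(ltr_pXn2r (n := 2)) ?nnegrE ?(ltW e0)//.
  rewrite -(ltr_pM2l m0); apply: le_lt_trans (decay _ _ xf t0) _.
  apply: (@le_lt_trans _ _ (W (x 0))).
    by rewrite ler_piMr ?W_ge0// -expR0 ler_expR mulNr oppr_le0 mulr_ge0// ltW.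
  apply: le_lt_trans (W_upper _) _.
  apply: (@lt_le_trans _ _ (M * (e * r) ^+ 2)).
    by rewrite ltr_pM2l// ltr_pXn2r// nnegrE// mulr_ge0// ltW.
  rewrite exprMn mulrCA [leRHS]mulrC ler_pM2l ?exprn_gt0// -ler_pdivlMl//.
  rewrite mulrC; apply: (@le_trans _ _ r); last by rewrite ge_min lexx orbT.
  by rewrite expr2 ler_piMl ?(ltW r0)// ge_min lexx.
- move=> x xf; apply/cvgrPdist_le => e e0.
  near=> t.
  have t0 : 0 <= t by near: t; exact: nbhs_pinfty_ge.
  rewrite sub0r normrN -(ler_pXn2r (n := 2)) ?nnegrE ?(ltW e0)//.
  rewrite -(ler_pM2l m0); apply: le_trans (decay _ _ xf t0) _.
  rewrite mulNr expRN ler_pdivrMr ?expR_gt0//.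
  apply: (@le_trans _ _ (m * e ^+ 2 * (k * t))); last first.
    rewrite ler_pM2l ?mulr_gt0 ?exprn_gt0//; apply: le_trans (expR_ge1Dx _).
    by rewrite lerDr.
  have me0 : 0 < m * e ^+ 2 by rewrite mulr_gt0// exprn_gt0.
  rewrite -ler_pdivrMl// -(ler_pdivrMl _ _ k0).
  by near: t; exact: nbhs_pinfty_ge (num_real _).
Unshelve. all: by end_near. Qed.

End ExponentialLyapunov.

(** * Weighted sums of squared coordinates *)

Section WeightedSquares.
Context {R : realType} {V : normedModType R}.
Variables (Q : max_coords V) (w : coord_index Q -> R).
Hypothesis w_gt0 : forall i, 0 < w i.

Definition wsq (u : V) : R := \sum_i w i * coordinate i u ^+ 2.

(** The differential of [wsq] at [u], applied to [v]. *)
Definition dwsq (u v : V) : R := 2 * \sum_i w i * (coordinate i u * coordinate i v).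

Lemma is_derive_bigsum (I : Type) (s : seq I) (h : I -> R -> R)
    (dh : I -> R) (t : R) :
  (forall i, is_derive t 1 (h i) (dh i)) ->
  is_derive t 1 (fun r => \sum_(i <- s) h i r) (\sum_(i <- s) dh i).
Proof.
move=> hd; elim: s => [|i s IH].
  rewrite big_nil (_ : (fun _ => _) = cst 0); first exact: is_derive_cst.
  by apply/funext => r; rewrite big_nil.
rewrite big_cons (_ : (fun _ => _) = h i \+ (fun r => \sum_(i <- s) h i r)).
  exact: is_deriveD.
by apply/funext => r; rewrite big_cons.
Qed.

Lemma wsq_chain (x : R -> V) (t : R) v :
  is_derive t 1 x v -> is_derive t 1 (wsq \o x) (dwsq (x t) v).
Proof.
move=> /(is_derive_coordP Q) xv.
rewrite /dwsq mulr_sumr; apply: is_derive_bigsum => i.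
rewrite (_ : 2 * _ = w i * (2 * coordinate i (x t) ^+ 1 * coordinate i v));
  last by ring.
apply: (@is_deriveZ _ _ _ (fun s => coordinate i (x s) ^+ 2)).
have := @is_deriveX _ _ (coordinate i \o x) 2 t 1 _ (xv i).
by rewrite /GRing.scale.
Qed.

Lemma continuous_wsq : continuous wsq.
Proof.
move=> u; apply: cvg_big => [|i _]; first exact: add_continuous.
apply: cvgM; first exact: cvg_cst.
exact: (continuous_comp (@continuous_coord _ _ Q i u) (@exprn_continuous R 2 _)).
Qed.

Lemma dwsqZ u a v : dwsq u (a *: v) = a * dwsq u v.
Proof.
rewrite /dwsq [RHS]mulrCA [a * _]mulr_sumr; congr (2 * _); apply: eq_bigr => i _.
by rewrite coordZ; ring.
Qed.

(** Each single term of the sum bounds one coordinate, and the norm is the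
    largest of them. *)
Lemma wsq_lower (m : R) v : 0 < m -> (forall i, m <= w i) -> m * `|v| ^+ 2 <= wsq v.
Proof.
move=> m0 mw; rewrite -ler_pdivlMl//.
have wsq0 : 0 <= m^-1 * wsq v.
  by rewrite mulr_ge0 ?invr_ge0 ?(ltW m0)// sumr_ge0// => i _;
    rewrite mulr_ge0 ?sqr_ge0// ltW.
rewrite -(sqr_sqrtr wsq0) ler_pXn2r ?nnegrE// ?sqrtr_ge0//.
apply/(norm_coordP Q); first exact: sqrtr_ge0.
move=> i; rewrite -(ler_pXn2r (n := 2)) ?nnegrE ?sqrtr_ge0// sqr_sqrtr//.
rewrite real_normK ?num_real//.
rewrite ler_pdivlMl//; apply: (@le_trans _ _ (w i * coordinate i v ^+ 2)).
  by rewrite ler_wpM2r ?sqr_ge0.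
rewrite /wsq (bigD1 i)//= lerDl sumr_ge0// => j _.
by rewrite mulr_ge0 ?sqr_ge0// ltW.
Qed.

Lemma wsq_upper v : wsq v <= (\sum_i w i) * `|v| ^+ 2.
Proof.
rewrite mulr_suml; apply: ler_sum => i _.
rewrite ler_pM2l// -[coordinate i v ^+ 2]real_normK ?num_real//.
by rewrite ler_pXn2r ?nnegrE// coord_le.
Qed.

End WeightedSquares.

(** * The state space of the converter *)

Section ConverterSpace.
Context {R : realType}.
Local Notation E := (R * 'cV[R]_2 * 'cV[R]_2)%type.

Lemma cV_normP n (v : 'cV[R]_n) (r : R) :
  0 <= r -> `|v| <= r <-> forall k, `|v k 0| <= r.
Proof.
move=> r0; rewrite [`|v|]mx_normrE; split=> [/bigmax_leP[_ h] k|h].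
  exact: (h (k, 0)).
by apply/bigmax_leP; split=> // -[k j] _ /=; rewrite [j]ord1.
Qed.

Definition state_coord (i : unit + 'I_2 + 'I_2) (x : E) : R :=
  match i with
  | inl (inl _) => x.1.1
  | inl (inr k) => x.1.2 k 0
  | inr k => x.2 k 0
  end.

Definition state_of_coord (c : unit + 'I_2 + 'I_2 -> R) : E :=
  (c (inl (inl tt)), \col_k c (inl (inr k)), \col_k c (inr k)).

Lemma state_coord_linear i a (u v : E) :
  state_coord i (a *: u + v) = a * state_coord i u + state_coord i v.
Proof. by case: i => [[[]|k]|k]; rewrite /= ?mxE. Qed.

Lemma state_normP (v : E) (r : R) :
  0 <= r -> `|v| <= r <-> forall i, `|state_coord i v| <= r.
Proof.
move=> r0; rewrite !prod_normE !ge_max; split.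
  move=> /andP[/andP[h0 /cV_normP h1] /cV_normP h2].
  by case=> [[[]|k]|k] /=; [exact: h0 | exact: h1 | exact: h2].
move=> h; apply/andP; split; [apply/andP; split|].
- exact: (h (inl (inl tt))).
- by apply/cV_normP => // k; exact: (h (inl (inr k))).
- by apply/cV_normP => // k; exact: (h (inr k)).
Qed.

Lemma state_of_coordK c i : state_coord i (state_of_coord c) = c i.
Proof. by case: i => [[[]|k]|k]; rewrite /= ?mxE. Qed.

Definition state_coords : max_coords E :=
  MaxCoords state_coord_linear state_normP state_of_coordK.

Lemma sum2E (F : 'I_2 -> R) : \sum_(k < 2) F k = F 0 + F 1.
Proof. by rewrite !big_ord_recl big_ord0 addr0; congr (_ + F _);
  exact: val_inj. Qed.

Lemma sum_stateE (F : unit + 'I_2 + 'I_2 -> R) :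
  \sum_i F i = F (inl (inl tt)) + (F (inl (inr 0)) + F (inl (inr 1)))
    + (F (inr 0) + F (inr 1)).
Proof. by rewrite big_sumType big_sumType/= !sum2E (big_pred1 tt)//; case. Qed.

Lemma J2_mul0 (u : 'cV[R]_2) : (J2 R *m u) 0 0 = - u 1 0.
Proof. by rewrite !mxE sum2E !mxE /=; ring. Qed.

Lemma J2_mul1 (u : 'cV[R]_2) : (J2 R *m u) 1 0 = u 0 0.
Proof. by rewrite !mxE sum2E !mxE /=; ring. Qed.

Lemma e2_mul (u : 'cV[R]_2) : ((e2 R)^T *m u) 0 0 = u 1 0.
Proof. by rewrite !mxE sum2E !mxE /=; ring. Qed.

Lemma lipschitz_on_balls_mulmx m n (A : 'M[R]_(m, n)) :
  lipschitz_on_balls (fun u : 'cV[R]_n => A *m u).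
Proof.
apply: (@lipschitz_lipschitz_on_balls _ _ _ _ (\sum_i \sum_j `|A i j|)) => u v.
rewrite -mulmxBr; apply/cV_normP => [|i].
  by rewrite mulr_ge0// sumr_ge0// => i _; exact: sumr_ge0.
rewrite mxE; apply: le_trans (ler_norm_sum _ _ _) _.
rewrite (bigD1 i)//= mulrDl ler_wpDr//.
  by rewrite mulr_ge0// sumr_ge0// => j _; exact: sumr_ge0.
rewrite mulr_suml; apply: ler_sum => j _; rewrite normrM ler_wpM2l//.
exact: (cV_normP (u - v) (normr_ge0 _)).1.
Qed.

Lemma lipschitz_on_balls_fst (U V : normedModType R) : lipschitz_on_balls (@fst U V).
Proof.
apply: (@lipschitz_lipschitz_on_balls _ _ _ _ 1) => u v.
by rewrite mul1r prod_normE le_max lexx.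
Qed.

Lemma lipschitz_on_balls_snd (U V : normedModType R) : lipschitz_on_balls (@snd U V).
Proof.
apply: (@lipschitz_lipschitz_on_balls _ _ _ _ 1) => u v.
by rewrite mul1r prod_normE le_max lexx orbT.
Qed.

End ConverterSpace.

(** * The converter *)

Section Converter.
Context {R : realType}.
Implicit Types (p : converter R).
Local Notation E := (R * 'cV[R]_2 * 'cV[R]_2)%type.

Lemma lipschitz_converter_field p : lipschitz_on_balls (converter_field p).
Proof.
have vdcL : lipschitz_on_balls (fun x : E => x.1.1).
  exact: lipschitz_on_balls_comp
    (@lipschitz_on_balls_fst _ _ _) (@lipschitz_on_balls_fst _ _ _).
have iL : lipschitz_on_balls (fun x : E => x.1.2).
  exact: lipschitz_on_balls_comp
    (@lipschitz_on_balls_fst _ _ _) (@lipschitz_on_balls_snd _ _ _).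
have vL : lipschitz_on_balls (fun x : E => x.2) by exact: lipschitz_on_balls_snd.
have scale (c : R) (V : normedModType R) (h : E -> V) :
    lipschitz_on_balls h -> lipschitz_on_balls (fun x => c *: h x).
  by move=> hL; apply: lipschitz_on_ballsZ => //; exact: lipschitz_on_balls_cst.
have vdc_scale (c : R) n (h : E -> 'cV[R]_n) : lipschitz_on_balls h ->
    lipschitz_on_balls (fun x => (c * x.1.1) *: h x).
  by move=> hL; apply: lipschitz_on_ballsZ => //; exact: (scale c _ _ vdcL).
have rotating (c d : R) (h : E -> 'cV[R]_2) : lipschitz_on_balls h ->
    lipschitz_on_balls (fun x => - ((c * x.1.1) *: J2 R + d%:M) *m h x).
  move=> hL.
  have -> : (fun x => - ((c * x.1.1) *: J2 R + d%:M) *m h x) =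
      (fun x => (- c * x.1.1) *: (J2 R *m h x) + (- d) *: h x).
    apply/funext => x.
    by rewrite mulNmx mulmxDl -scalemxAl mul_scalar_mx opprD mulNr !scaleNr.
  apply: (@lipschitz_on_ballsD _ E 'cV[R]_2); last exact: scale.
  apply: vdc_scale.
  apply: (lipschitz_on_balls_comp (g := fun u : 'cV[R]_2 => J2 R *m u) hL).
  exact: lipschitz_on_balls_mulmx.
have -> : converter_field p = (fun x : E =>
   ((Cdc p)^-1 *: (- Gdc p *: x.1.1 + (idc p + (- (mu p / 2)) *: x.1.2 1 0)),
   (Lac p)^-1 *: (- ((Lac p * eta p * x.1.1) *: J2 R + (Rac p)%:M) *m x.1.2
      + ((mu p / 2 * x.1.1) *: e2 R + (-1) *: x.2)),
   (Cac p)^-1 *: (- ((Cac p * eta p * x.1.1) *: J2 R + (gload p)%:M) *m x.2 + x.1.2))).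
  apply/funext => -[[vdc i] v] /=.
  rewrite e2_mul scaleN1r !addrA; congr (_, _, _).
  by rewrite /GRing.scale/=; ring.
apply: lipschitz_on_balls_pair; first apply: lipschitz_on_balls_pair.
- apply: (scale); apply: (@lipschitz_on_ballsD _ E R);
    first exact: (scale _ _ _ vdcL).
  apply: (@lipschitz_on_ballsD _ E R); first exact: lipschitz_on_balls_cst.
  apply: (scale _ R^o (fun x : E => x.1.2 1 0)).
  apply: (lipschitz_on_balls_comp iL (g := fun u : 'cV[R]_2 => u 1 0)).
  apply: (@lipschitz_lipschitz_on_balls _ _ _ _ 1) => u v.
  have := (cV_normP (u - v) (normr_ge0 _)).1 (lexx _) 1.
  by rewrite !mxE mul1r.
- apply: (scale); apply: (@lipschitz_on_ballsD _ E 'cV[R]_2); first exact: rotating.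
  apply: (@lipschitz_on_ballsD _ E 'cV[R]_2); last exact: scale.
  by apply: (vdc_scale); exact: lipschitz_on_balls_cst.
- by apply: (scale); apply: (@lipschitz_on_ballsD _ E 'cV[R]_2) => //;
    exact: rotating.
Qed.

Lemma lipschitz_error_field p (xs : E) :
  lipschitz_on_balls (error_field (converter_field p) xs).
Proof.
apply: lipschitz_on_balls_comp (lipschitz_converter_field p).
apply: (@lipschitz_on_ballsD _ E E);
  [exact: lipschitz_on_balls_cst | exact: lipschitz_on_balls_id].
Qed.

Lemma young (c x y : R) : 0 < c -> x * y <= c * x ^+ 2 + y ^+ 2 / (4 * c).
Proof.
move=> c0; rewrite -subr_ge0.
have -> : c * x ^+ 2 + y ^+ 2 / (4 * c) - x * y = (2 * c * x - y) ^+ 2 / (4 * c).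
  by field; rewrite gt_eqF.
by rewrite divr_ge0 ?sqr_ge0// mulr_ge0// ltW.
Qed.

(** Write [sigma < 1] for the ratio of the two sides of the gain condition.  Young's
    inequality with weight [theta] on each of the four products bounds the left side by
    [theta * Ra * |i| ^+ 2 + theta * g * |v| ^+ 2 + sigma / theta * G * e ^+ 2], and
    [theta = (1 + sigma) / 2] satisfies [sigma <= theta ^+ 2] by the
    inequality of arithmetic and geometric means. *)
Lemma cross_term_bound (G Ra g h L C a0 a1 b0 b1 : R) :
  0 < G -> 0 < Ra -> 0 < g ->
  Ra * C ^+ 2 * h ^+ 2 * (b0 ^+ 2 + b1 ^+ 2) + g * L ^+ 2 * h ^+ 2 * (a0 ^+ 2 + a1 ^+ 2)
    < 4 * Ra * G * g ->
  exists2 theta : R, 0 < theta < 1 & forall e i0 i1 v0 v1 : R,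
    e * (h * (L * (i0 * a1 - i1 * a0) + C * (v0 * b1 - v1 * b0)))
    <= theta * (G * e ^+ 2 + Ra * (i0 ^+ 2 + i1 ^+ 2) + g * (v0 ^+ 2 + v1 ^+ 2)).
Proof.
move=> G0 Ra0 g0; set N := 4 * Ra * G * g; set S := (X in X < _) => SN.
have N0 : 0 < N by rewrite !mulr_gt0.
have term_ge0 (r x y s t : R) : 0 < r ->
  0 <= r * x ^+ 2 * y ^+ 2 * (s ^+ 2 + t ^+ 2).
  move=> /ltW r0; apply: mulr_ge0; last by rewrite addr_ge0 ?sqr_ge0.
  by rewrite mulr_ge0 ?sqr_ge0// mulr_ge0 ?sqr_ge0.
have S0 : 0 <= S by apply: addr_ge0; exact: term_ge0.
pose sigma := S / N.
have sigma0 : 0 <= sigma by rewrite divr_ge0// ltW.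
have sigma1 : sigma < 1 by rewrite ltr_pdivrMr// mul1r.
pose theta := (1 + sigma) / 2; exists theta; first by rewrite /theta; lra.
have theta0 : 0 < theta by rewrite /theta; lra.
move=> e i0 i1 v0 v1.
have Yi0 := young i0 (e * h * L * a1) (mulr_gt0 theta0 Ra0).
have Yi1 := young i1 (- (e * h * L * a0)) (mulr_gt0 theta0 Ra0).
have Yv0 := young v0 (e * h * C * b1) (mulr_gt0 theta0 g0).
have Yv1 := young v1 (- (e * h * C * b0)) (mulr_gt0 theta0 g0).
have sum_rest : (e * h * L * a1) ^+ 2 / (4 * (theta * Ra))
    + (- (e * h * L * a0)) ^+ 2 / (4 * (theta * Ra))
    + (e * h * C * b1) ^+ 2 / (4 * (theta * g))
    + (- (e * h * C * b0)) ^+ 2 / (4 * (theta * g)) <= theta * (G * e ^+ 2).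
  rewrite [leLHS](_ : _ = sigma / theta * (G * e ^+ 2)); last first.
    by rewrite /sigma /S /N; field; rewrite !gt_eqF.
  apply: ler_wpM2r; first by rewrite mulr_ge0 ?sqr_ge0// ltW.
  rewrite ler_pdivrMr// -subr_ge0 (_ : _ - _ = ((1 - sigma) / 2) ^+ 2) ?sqr_ge0//.
  by rewrite /theta; field.
lra.
Qed.

Definition energy_weight p (i : unit + 'I_2 + 'I_2) : R :=
  match i with inl (inl _) => Cdc p | inl (inr _) => Lac p | inr _ => Cac p end.

(** After subtraction of the equilibrium equations, the couplings between [e0]
    and [i] and between [i] and [v] cancel in the energy balance, and
    [(vdc_s + e0) J i], [(vdc_s + e0) J v] are orthogonal to [i], [v].  What remains
    is the dissipation and the cross term produced by [e0 J i_s] and [e0 J v_s]. *)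
Lemma energy_decay p (vdc_s : R) (i_s v_s : 'cV[R]_2) :
  0 < Cdc p -> 0 < Gdc p -> 0 < Cac p -> 0 < Lac p -> 0 < Rac p -> 0 < gload p ->
  equilibrium (converter_field p) (vdc_s, i_s, v_s) ->
  Rac p * Cac p ^+ 2 * eta p ^+ 2 * norm2 v_s ^+ 2
    + gload p * Lac p ^+ 2 * eta p ^+ 2 * norm2 i_s ^+ 2
    < 4 * Rac p * Gdc p * gload p ->
  exists2 k : R, 0 < k & forall e : E,
    dwsq (Q := state_coords) (energy_weight p) e
      (error_field (converter_field p) (vdc_s, i_s, v_s) e)
    <= - k * wsq (Q := state_coords) (energy_weight p) e.
Proof.
move=> Cdc0 G0 C0 L0 R0 g0 eqs.
have norm2E (u : 'cV[R]_2) : norm2 u ^+ 2 = u 0 0 ^+ 2 + u 1 0 ^+ 2.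
  by rewrite sqr_sqrtr ?sum2E// addr_ge0 ?sqr_ge0.
rewrite !norm2E => /(cross_term_bound G0 R0 g0)[theta /andP[_ theta1] cross].
pose kappa := Num.min (Gdc p / Cdc p) (Num.min (Rac p / Lac p) (gload p / Cac p)).
have kappa0 : 0 < kappa by rewrite !lt_min !divr_gt0.
exists (2 * (1 - theta) * kappa); first by rewrite !mulr_gt0// subr_gt0.
move=> -[[e0 i] v].
have kC : kappa * Cdc p <= Gdc p by rewrite -ler_pdivlMr// ge_min lexx.
have kL : kappa * Lac p <= Rac p by rewrite -ler_pdivlMr// !ge_min lexx !orbT.
have kc : kappa * Cac p <= gload p by rewrite -ler_pdivlMr// !ge_min lexx !orbT.
(* The equilibrium equations with the prefactors 1 / C_dc, 1 / L, 1 / C removed. *)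
have eq0 : - Gdc p * vdc_s + idc p - mu p / 2 * i_s 1 0 = 0.
  have : (converter_field p (vdc_s, i_s, v_s)).1.1 = 0 by rewrite eqs.
  by rewrite /= e2_mul => /eqP; rewrite mulf_eq0 invr_eq0 gt_eqF//= => /eqP.
pose Ji k (u : 'cV[R]_2) := (J2 R *m u) k 0.
have eqi k : - (Lac p * eta p * vdc_s) * Ji k i_s - Rac p * i_s k 0
    + mu p / 2 * vdc_s * e2 R k 0 - v_s k 0 = 0.
  have : (converter_field p (vdc_s, i_s, v_s)).1.2 k 0 = 0 by rewrite eqs mxE.
  rewrite /= mulNmx mulmxDl -scalemxAl mul_scalar_mx => /eqP.
  rewrite mxE mulf_eq0 invr_eq0 gt_eqF//= => /eqP.
  by rewrite !mxE -/(Ji k i_s) => <-; rewrite /Ji mxE; ring.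
have eqv k : - (Cac p * eta p * vdc_s) * Ji k v_s - gload p * v_s k 0 + i_s k 0 = 0.
  have : (converter_field p (vdc_s, i_s, v_s)).2 k 0 = 0 by rewrite eqs mxE.
  rewrite /= mulNmx mulmxDl -scalemxAl mul_scalar_mx => /eqP.
  rewrite mxE mulf_eq0 invr_eq0 gt_eqF//= => /eqP.
  by rewrite !mxE => <-; rewrite /Ji mxE; ring.
set f := error_field _ _ _.
have cancel (c x y z : R) : 0 < c -> y = c^-1 * z -> c * (x * y) = x * z.
  by move=> c0 ->; field; rewrite gt_eqF.
have f0 : f.1.1 = (Cdc p)^-1 * (- Gdc p * e0 - mu p / 2 * i 1 0).
  rewrite /= e2_mul mxE; congr (_ * _); lra.
have fi k : f.1.2 k 0 = (Lac p)^-1 *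
    (- (Lac p * eta p) * ((vdc_s + e0) * Ji k i + e0 * Ji k i_s)
    - Rac p * i k 0 + mu p / 2 * e0 * e2 R k 0 - v k 0).
  rewrite /= mulNmx mulmxDl -scalemxAl mul_scalar_mx mulmxDr mxE; congr (_ * _).
  by rewrite -[LHS]subr0 -(eqi k) !mxE /Ji ![(J2 R *m _) k 0]mxE; ring.
have fv k : f.2 k 0 = (Cac p)^-1 *
    (- (Cac p * eta p) * ((vdc_s + e0) * Ji k v + e0 * Ji k v_s)
    - gload p * v k 0 + i k 0).
  rewrite /= mulNmx mulmxDl -scalemxAl mul_scalar_mx mulmxDr mxE; congr (_ * _).
  by rewrite -[LHS]subr0 -(eqv k) !mxE /Ji ![(J2 R *m _) k 0]mxE; ring.
rewrite /dwsq /wsq !sum_stateE /=.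
rewrite (cancel _ _ _ _ Cdc0 f0) !(cancel _ _ _ _ L0 (fi _)) !(cancel _ _ _ _ C0 (fv _)).
rewrite /Ji !J2_mul0 !J2_mul1 !mxE /=.
have := cross e0 (i 0 0) (i 1 0) (v 0 0) (v 1 0).
set D := (X in theta * X) => crossD; set W := (X in _ <= _ * X).
have WD : kappa * W <= D.
  have term (c d x : R) : kappa * c <= d -> kappa * (c * x ^+ 2) <= d * x ^+ 2.
    by move=> cd; rewrite mulrA ler_wpM2r ?sqr_ge0.
  rewrite /W /D !mulrDr.
  by rewrite !lerD ?term.
apply: (@le_trans _ _ (- (2 * (1 - theta)) * D)); last first.
  by rewrite !mulNr lerN2 -[leLHS]mulrA ler_pM2l// mulr_gt0// subr_gt0.
rewrite /D in crossD *; lra.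
Qed.

End Converter.

Theorem mainTheorem2 (R : realType) (p : converter R)
    (Cdc_gt0 : 0 < Cdc p) (Gdc_gt0 : 0 < Gdc p)
    (C_gt0 : 0 < Cac p) (L_gt0 : 0 < Lac p) (R_gt0 : 0 < Rac p)
    (eta_gt0 : 0 < eta p) (g_gt0 : 0 < gload p)
    (mu_gt0 : 0 < mu p) (mu_le1 : mu p <= 1) (idc_gt0 : 0 < idc p)
    (vdc_s : R) (i_s v_s : 'cV[R]_2)
    (eq_s : unique_equilibrium (converter_field p) (vdc_s, i_s, v_s))
    (gain : Rac p * Cac p ^+ 2 * eta p ^+ 2 * norm2 v_s ^+ 2
            + gload p * Lac p ^+ 2 * eta p ^+ 2 * norm2 i_s ^+ 2
            < 4 * Rac p * Gdc p * gload p) :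
  globally_asymptotically_stable
    (error_field (converter_field p) (vdc_s, i_s, v_s)) 0.
Proof.
have [k k0 decay] := energy_decay Cdc_gt0 Gdc_gt0 C_gt0 L_gt0 R_gt0 g_gt0 eq_s.1 gain.
have w_gt0 (i : coord_index (@state_coords R)) : 0 < energy_weight p i.
  by case: i => [[]|].
pose m := Num.min (Cdc p) (Num.min (Lac p) (Cac p)).
have m0 : 0 < m by rewrite !lt_min Cdc_gt0 L_gt0.
have mw (i : coord_index (@state_coords R)) : m <= energy_weight p i.
  by case: i => [[i|i]|i]; rewrite /= /m !ge_min lexx ?orbT.
have M0 : 0 < \sum_(i : coord_index (@state_coords R)) energy_weight p i.
  by rewrite sum_stateE /= !addr_gt0.
apply: (exponential_lyapunov state_coords m0 M0 k0 _ _ _ _ _ _ decay).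
- exact: lipschitz_error_field.
- exact: continuous_wsq.
- exact: wsq_chain.
- exact: dwsqZ.
- by move=> v; exact: wsq_lower.
- by move=> v; exact: wsq_upper.
Qed.
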